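(* Let $k\ge2$. Every fair (possibly randomized) online algorithm FAIR for Edge-$k$-Coloring(Tree) satisfies $$C_{\mathrm{FAIR}}^{\text{Tree}}(k)\ge\frac{2\sqrt{k}-2}{2\sqrt{k}-1}.$$
   Context: Online dual edge coloring, Edge-$k$-Coloring: a number $k$ of colors $1,\dots,k$ is given. The edges of a simple graph arrive one by one, each specified by its two endpoints. Upon arrival, an edge must irrevocably either be colored with one of the $k$ colors, such that no two adjacent (sharing an endpoint) colored edges receive the same color, or be rejected. The goal is to color as many edges as possible. Edge-$k$-Coloring(Tree) denotes the restriction to inputs whose graph is a tree. Competitive ratio: for an input sequence $\sigma$, let $E[\mathrm{ALG}(\sigma)]$ be the expected number of edges colored by ALG and $\mathrm{OPT}(\sigma)$ the maximum number of edges of the input graph that can be properly colored with $k$ colors. ALG is $C$-competitive if there is a constant $b$ with $E[\mathrm{ALG}(\sigma)]\ge C\cdot\mathrm{OPT}(\sigma)-b$ for all inputs $\sigma$; the competitive ratio $C_{\mathrm{ALG}}^{\text{Tree}}(k)$ is the supremum of all such $C$. An algorithm is fair if it never rejects an edge unless all $k$ colors are already used on edges adjacent to it. *)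

(* Defs.v *)
From HB Require Import structures.
From mathcomp Require Import all_boot all_order all_algebra finmap.
From mathcomp Require Import all_classical all_reals all_analysis.
Set Implicit Arguments.
Unset Strict Implicit.
Unset Printing Implicit Defensive.
Import Order.TTheory GRing.Theory Num.Theory.

Local Open Scope fset_scope.

Definition edge := {fset nat}.

(* An input is the sequence of the edges in order of arrival. *)
Definition simple_graph (s : seq edge) : bool :=
  uniq s && all (fun e : edge => #|` e| == 2) s.

Definition adj (s : seq edge) : rel nat := fun u v => [fset u; v] \in s.

Definition connected_graph (s : seq edge) : Prop :=
  forall e f : edge, e \in s -> f \in s ->
  forall u v : nat, u \in e -> v \in f ->
  exists2 p : seq nat, path (adj s) u p & last u p = v.

(* The bound on the size is needed because the two endpoints of a single edge
   form a ucycle of size 2. *)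
Definition acyclic_graph (s : seq edge) : Prop :=
  forall c : seq nat, (2 < size c)%N -> ~ ucycle (adj s) c.

(* Only the graph of the whole sequence is a tree: the edges may arrive in any
   order, so a proper prefix may be a disconnected forest.  The vertices of the
   graph are the endpoints of its edges, and the empty sequence is allowed. *)
Definition tree_input (s : seq edge) : Prop :=
  [/\ simple_graph s, connected_graph s & acyclic_graph s].

Definition edges_meet (s : seq edge) (i j : 'I_(size s)) : bool :=
  nth fset0 s i `&` nth fset0 s j != fset0.

(* A coloring maps the i-th edge to None if that edge is not colored. *)
Definition coloring (k : nat) (s : seq edge) : finType :=
  {ffun 'I_(size s) -> option 'I_k}.

Definition proper_coloring (k : nat) (s : seq edge) (phi : coloring k s) : bool :=
  [forall i, forall j,
     [&& i != j, edges_meet i j & isSome (phi i)] ==> (phi i != phi j)].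

Definition num_colored (k : nat) (s : seq edge) (phi : coloring k s) : nat :=
  #|[pred i | isSome (phi i)]|.

Definition OPT (k : nat) (s : seq edge) : nat :=
  \max_(phi : coloring k s | proper_coloring phi) num_colored phi.

(* A past e is the irrevocable decision on the edge e arriving after the edges
   of past; None is a rejection.  The earlier decisions of A are themselves
   determined by past. *)
Definition online_algorithm (k : nat) : Type :=
  seq edge -> edge -> option 'I_k.

Definition online_coloring (k : nat) (A : online_algorithm k) (s : seq edge) :
    coloring k s :=
  [ffun i : 'I_(size s) => A (take i s) (nth fset0 s i)].

Definition tree_algorithm (k : nat) (A : online_algorithm k) : Prop :=
  forall s : seq edge, tree_input s -> proper_coloring (online_coloring A s).

Definition fair (k : nat) (A : online_algorithm k) : Prop :=
  forall s : seq edge, tree_input s ->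
  forall i : 'I_(size s), online_coloring A s i = None ->
  forall c : 'I_k, exists j : 'I_(size s),
    [/\ (j < i)%N, edges_meet i j & online_coloring A s j = Some c].

(* A randomized algorithm is a random deterministic algorithm; the decision on
   each edge must be a measurable function of the outcome. *)
Definition randomized_tree_algorithm (k : nat) (d : measure_display)
    (Omega : measurableType d) (A : Omega -> online_algorithm k) : Prop :=
  (forall w : Omega, tree_algorithm (A w)) /\
  (forall s : seq edge, tree_input s ->
   forall (i : 'I_(size s)) (c : option 'I_k),
     measurable [set w : Omega | online_coloring (A w) s i = c]%classic).

Definition competitive (R : realType) (k : nat) (d : measure_display)
    (Omega : measurableType d) (P : probability Omega R)
    (A : Omega -> online_algorithm k) (C : R) : Prop :=
  exists b : R, forall s : seq edge, tree_input s ->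
    ((C * (OPT k s)%:R - b)%R%:E <=
       'E_P[fun w => ((num_colored (online_coloring (A w) s))%:R)%R])%E.

Definition competitive_ratio (R : realType) (k : nat) (d : measure_display)
    (Omega : measurableType d) (P : probability Omega R)
    (A : Omega -> online_algorithm k) : \bar R :=
  ereal_sup [set C%:E | C in [set C : R | competitive P A C]]%classic.

(* Main.v *)
(**
  Orient the forest so that every edge points to one of its endpoints, its
  child, and no vertex is the child of two edges.  Let [D] be the edges colored
  by the fair algorithm, [O] those of an optimal coloring, [q = 2 sqrt k - 2],
  and let [d v] be the degree of [v] in [D].  Each edge of [D] brings its parent
  endpoint 1, plus [q] if it is not in [O], while each edge of [O \ D] costs its
  child [q].  A child [v] left with a deficit passes [min 0 (d v - q)] up to the
  parent [u] of its edge in [O \ D]; fairness bounds this below by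
  [min 0 (k - d u - q)].  Both colorings have degree at most [k], and with
  [r = k - d u] the balance of every vertex [u] reduces to a sum of terms such
  as [(sqrt k - r)^2] or [(sqrt k - r - 1)^2], so it is nonnegative.  Summing
  over the vertices, the passed deficits cancel, and what remains is
  [q |O| <= (q + 1) |D|].
*)

Require Import Defs.
From mathcomp Require Import all_boot all_order all_algebra finmap.
From mathcomp Require Import all_classical all_reals all_analysis.
From mathcomp Require Import zify ring lra.
Set Implicit Arguments.
Unset Strict Implicit.
Unset Printing Implicit Defensive.
Import Order.TTheory GRing.Theory Num.Theory.
Local Open Scope ring_scope.

(** * Charging along an oriented forest *)

Lemma sqrt_nat_ge1 (R : rcfType) k : (0 < k)%N -> 1 <= Num.sqrt k%:R :> R.
Proof. by move=> k_gt0; rewrite -{1}[1]sqrtr1 ler_sqrt ?ler1n ?ltr0n. Qed.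

(* [aX], [aY], [aH] count the edges of [D :&: O], [D :\: O] and [O :\: D] whose
   child is the given vertex, and [pX], [pY], [pH] those whose parent it is. *)
Lemma vertex_charge (R : rcfType) (k aX aY aH pX pY pH : nat)
    (s := Num.sqrt k%:R : R) (q := 2 * s - 2)
    (d := (aX + aY + pX + pY)%:R : R) :
    (0 < k)%N -> (aX + aY + aH <= 1)%N -> (aX + aY + pX + pY <= k)%N ->
    (aX + aH + pX + pH <= k)%N ->
  0 <= (pX + pY)%:R + q * pY%:R - q * aH%:R
       + pH%:R * Num.min 0 (k%:R - d - q) - aH%:R * Num.min 0 (d - q).
Proof.
move=> k_gt0 a_le1 dk ok.
have sk : s * s = k%:R by rewrite -expr2 sqr_sqrtr ?ler0n.
have s1 : 1 <= s by exact: sqrt_nat_ge1.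
have k1 : 1 <= k%:R :> R by rewrite ler1n.
have q0 : 0 <= q by rewrite /q; lra.
have pX0 : 0 <= pX%:R :> R by [].
have pY0 : 0 <= pY%:R :> R by [].
have pH0 : 0 <= pH%:R :> R by [].
have dkR : d <= k%:R by rewrite ler_nat.
have okR : aX%:R + aH%:R + pX%:R + pH%:R <= k%:R :> R by rewrite -!natrD ler_nat.
have dE : d = aX%:R + aY%:R + pX%:R + pY%:R by rewrite /d !natrD.
have qpY : 0 <= q * pY%:R by rewrite mulr_ge0.
have aHm : aH%:R * Num.min 0 (d - q) <= 0.
  by rewrite mulr_ge0_le0 // ge_min lexx.
rewrite natrD.
(* In the first case the bound on the received deficits is 0, and a vertex with [aH = 1] passes on
   whatever part of [q] its degree [d] does not cover. *)
have [qr|rq] := leP 0 (k%:R - d - q).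
  rewrite mulr0 addr0.
  case: aH a_le1 {ok okR aHm} => [|[|//]] a_le1; last by lia.
    by rewrite mulr0n !mulr0 mul0r; lra.
  have [aX0 aY0] : aX = 0%N /\ aY = 0%N by lia.
  rewrite mulr1n mulr1 mul1r; move: dE; rewrite aX0 aY0 mulr0n.
  by have [] := leP 0 (d - q); lra.
set r := k%:R - d in rq *.
have r0 : 0 <= r by rewrite subr_ge0.
(* [r] is an integer, so it avoids the open interval from 0 to 1; the case [aX = 1] uses this. *)
have r01 : r = 0 \/ 1 <= r.
  rewrite /r /d -natrB //; case: (k - _)%N => [|n]; first by left.
  by right; rewrite ler1n.
(* The degree bound for [O] gives [pH <= r + aY + pY - aH], and since [r - q < 0] this largest value
   of [pH] is the worst case. *)
suff : 0 <= pX%:R + pY%:R + q * pY%:R - q * aH%:R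
            + (r + aY%:R + pY%:R - aH%:R) * (r - q).
  have : (r + aY%:R + pY%:R - aH%:R) * (r - q) <= pH%:R * (r - q).
    by rewrite ler_wnM2r; [| lra | rewrite /r; lra].
  by lra.
have rpY : 0 <= r * pY%:R by rewrite mulr_ge0.
(* Eliminating [pX] through [k = s * s] completes a square. *)
have -> : pX%:R + pY%:R + q * pY%:R - q * aH%:R
            + (r + aY%:R + pY%:R - aH%:R) * (r - q) =
  (s - r) ^+ 2 + r - aX%:R - aY%:R * (1 + q - r) - r * aH%:R + r * pY%:R.
  have -> : pX%:R = s * s - r - aX%:R - aY%:R - pY%:R by rewrite sk /r; lra.
  by rewrite /q; ring.
have sq0 : 0 <= (s - r) ^+ 2 by exact: sqr_ge0.
have sq1 : 0 <= (s - r - 1) ^+ 2 by exact: sqr_ge0.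
have : [\/ [/\ aX = 0, aY = 0 & aH = 0], [/\ aX = 1, aY = 0 & aH = 0],
          [/\ aX = 0, aY = 1 & aH = 0] | [/\ aX = 0, aY = 0 & aH = 1]]%N.
  case: aX a_le1 {dk ok okR dE d dkR aHm rq r r0 r01 rpY sq0 sq1} => [|[|//]].
  - case: aY => [|[|//]]; case: aH => [|[|//]] // _.
    + by constructor 1. + by constructor 4. + by constructor 3.
  - by case: aY => [|//]; case: aH => [|//] // _; constructor 2.
case=> -[-> -> ->]; rewrite ?mulr0n ?mulr1n ?mul0r ?mulr0 ?mulr1 ?mul1r.
- by lra.
- have [r_eq0|r1] := r01; last by lra.
  have : (s - r) ^+ 2 = k%:R by rewrite r_eq0 subr0 expr2.
  by lra.
(* With [q = 2 * s - 2] the balance here is exactly [(s - r - 1) ^+ 2 + r * pY]. *)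
- have -> : (s - r) ^+ 2 = (s - r - 1) ^+ 2 + 2 * (s - r) - 1 by ring.
  by rewrite /q; lra.
- by lra.
Qed.

(** The last hypothesis is what fairness provides: the edges carrying the [k] colors that block an
    uncolored edge all meet one of its two endpoints. *)
Lemma oriented_forest_bound (R : rcfType) (k : nat) (V I : finType)
    (ch par : I -> V) (D O : {set I})
    (deg := fun (S : {set I}) v => #|[set i in S | (ch i == v) || (par i == v)]|)
    (q := 2 * Num.sqrt k%:R - 2 : R) :
    (0 < k)%N -> injective ch -> (forall i, ch i != par i) ->
    (forall v, (deg D v <= k)%N) -> (forall v, (deg O v <= k)%N) ->
    (forall i, i \notin D -> (k <= deg D (ch i) + deg D (par i))%N) ->
  q * #|O|%:R <= (q + 1) * #|D|%:R.
Proof.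
move=> k_gt0 ch_inj chpar degD degO degH.
pose a (S : {set I}) v := #|[set i in S | ch i == v]|.
pose p (S : {set I}) v := #|[set i in S | par i == v]|.
have degE S v : deg S v = (a S v + p S v)%N.
  rewrite /deg /a /p -cardsUI.
  rewrite [X in (_ + X)%N](_ : _ = 0%N) ?addn0; last first.
    apply: eq_card0 => i; rewrite !inE; case: eqP => [<-|_]; rewrite ?andbF //.
    by rewrite eq_sym (negPf (chpar i)) !andbF.
  by apply: eq_card => i; rewrite !inE -andb_orr.
pose X := D :&: O; pose Y := D :\: O; pose H := O :\: D.
have cardID (f : I -> V) (S T : {set I}) v :
    #|[set i in S | f i == v]| =
    (#|[set i in S :&: T | f i == v]| + #|[set i in S :\: T | f i == v]|)%N.
  rewrite -(cardsID T); congr (_ + _)%N; apply: eq_card => i; rewrite !inE.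
    by rewrite andbAC.
  by rewrite andbA.
have aD v : a D v = (a X v + a Y v)%N by exact: cardID.
have pD v : p D v = (p X v + p Y v)%N by exact: cardID.
have aO v : a O v = (a X v + a H v)%N by rewrite /X finset.setIC; exact: cardID.
have pO v : p O v = (p X v + p H v)%N by rewrite /X finset.setIC; exact: cardID.
have a_le1 v : (a X v + a Y v + a H v <= 1)%N.
  rewrite -aD /a -cardsUI.
  rewrite [X in (_ + X)%N](_ : _ = 0%N) ?addn0; last first.
    by apply: eq_card0 => i; rewrite !inE; case: (i \in D); rewrite ?andbF.
  apply/card_le1P => i; rewrite inE => iv j.
  have chi : ch i = v by case/orP: iv; rewrite inE => /andP[_ /eqP].
  rewrite !inE; apply/idP/eqP => [jv|->]; last by rewrite !inE in iv.
  by apply: ch_inj; rewrite chi; case/orP: jv => /andP[_ /eqP].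
pose g v : R := Num.min 0 ((deg D v)%:R - q).
have set_sum (f : I -> V) (S : {set I}) v (F : I -> R) :
    \sum_(i in S | f i == v) F i = \sum_(i in [set i in S | f i == v]) F i.
  by apply: eq_bigl => i; rewrite inE.
have charge v : 0 <= (p D v)%:R + q * (p Y v)%:R - q * (a H v)%:R
    + \sum_(i in H | par i == v) g (ch i) - \sum_(i in H | ch i == v) g (ch i).
  have dE : deg D v = (a X v + a Y v + p X v + p Y v)%N.
    by rewrite degE aD pD; lia.
  have := @vertex_charge R k (a X v) (a Y v) (a H v) (p X v) (p Y v) (p H v)
            k_gt0 (a_le1 v).
  rewrite -dE => /(_ (degD v)).
  have -> : (a X v + a H v + p X v + p H v = deg O v)%N.
    by rewrite degE aO pO; lia.
  move=> /(_ (degO v)); rewrite -pD -/q => /le_trans; apply.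
  rewrite !set_sum.
  have -> : \sum_(i in [set i in H | ch i == v]) g (ch i) = (a H v)%:R * g v.
    rewrite (eq_bigr (fun=> g v)); last by move=> i; rewrite inE => /andP[_ /eqP->].
    by rewrite sumr_const mulr_natl.
  rewrite lerD2r lerD2l mulr_natl -sumr_const; apply: ler_sum => i.
  rewrite !inE => /andP[/andP[iD _] /eqP iv].
  have := degH i iD; rewrite iv -(ler_nat R) natrD => degi.
  by rewrite le_min ge_min lexx /= ge_min; apply/orP; right; lra.
have partition (f : I -> V) (S : {set I}) (F : I -> R) :
    \sum_v \sum_(i in S | f i == v) F i = \sum_(i in S) F i.
  by rewrite [RHS](partition_big f predT).
have card_sum (f : I -> V) (S : {set I}) :
    \sum_v #|[set i in S | f i == v]|%:R = #|S|%:R :> R.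
  rewrite -sum1_card natr_sum -(partition f); apply: eq_bigr => v _.
  by rewrite -sum1_card natr_sum; apply: eq_bigl => i; rewrite inE.
(* Each edge of [H] contributes [g (ch i)] positively at its parent and negatively at its child, so
   [addrK] cancels these sums. There remains [q |H| <= |D| + q |Y|]; adding [q |X|] to both sides
   gives the claim. *)
have := sumr_ge0 (index_enum V) (P := xpredT) (fun v _ => charge v).
rewrite sumrB !big_split /= sumrN -!mulr_sumr !partition.
rewrite [\sum_i (p D i)%:R]card_sum [\sum_i (p Y i)%:R]card_sum.
rewrite [\sum_i (a H i)%:R]card_sum addrK.
have /(congr1 (fun n => n%:R : R)) := cardsID O D.
have /(congr1 (fun n => n%:R : R)) := cardsID D O.
rewrite finset.setIC !natrD -/X -/Y -/H => <- <-.
by lra.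
Qed.

Local Close Scope ring_scope.
Local Open Scope fset_scope.

(** * Leaves and orientations of acyclic graphs *)

Lemma fset_card2P (K : choiceType) (A : {fset K}) x :
  #|` A| = 2 -> x \in A -> exists2 y, x != y & A = [fset x; y].
Proof.
move=> A2 xA; have : #|` A `\ x| == 1 by move: A2; rewrite (cardfsD1 x) xA; lia.
case/cardfs1P => y Ay; exists y.
  have : y \in A `\ x by rewrite Ay inE.
  by rewrite !inE eq_sym => /andP[].
by rewrite -(fsetD1K xA) Ay.
Qed.

Lemma adj_sym s u v : adj s u v = adj s v u.
Proof. by rewrite /adj fsetUC. Qed.

Lemma adj_neq s u v : simple_graph s -> adj s u v -> u != v.
Proof.
case/andP=> _ /allP s2 /s2; rewrite cardfs2.
by case: (u != v).
Qed.

(* Without a leaf, a simple path can be extended forever: a neighbor of its first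
   vertex [x] other than the second one [y] is not on the path by acyclicity. *)
Lemma acyclic_leaf s : simple_graph s -> acyclic_graph s -> s != [::] ->
  exists e v, [/\ e \in s, v \in e & forall f, f \in s -> v \in f -> f = e].
Proof.
move=> simp acyc s_neq0; apply: contrapT => noleaf.
have /andP[_ /allP s2] := simp.
have branch u v : adj s u v -> exists2 w, adj s u w & w != v.
  move=> uv; apply: contrapT => nobranch; apply: noleaf.
  exists [fset u; v], u; split => // [|f fs uf]; first by rewrite !inE eqxx.
  have [w _ fE] := fset_card2P (eqP (s2 f fs)) uf.
  apply: contrapT => f_neq; apply: nobranch; exists w; first by rewrite /adj -fE.
  by apply/eqP => wv; apply: f_neq; rewrite fE wv.
pose verts := flatten [seq enum_fset f | f <- s].
have in_verts u v : adj s u v -> u \in verts.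
  move=> uv; apply/flattenP; exists (enum_fset [fset u; v]); first exact: map_f.
  by rewrite -[_ \in _]/(u \in [fset u; v]) !inE eqxx.
have long n : exists x y p, [/\ path (adj s) x (y :: p), uniq (x :: y :: p)
    & size p = n].
  elim: n => [|n [x [y [p [xyp uxyp szp]]]]].
    case: s s_neq0 simp s2 {acyc noleaf branch verts in_verts} => // e s _ simp s2.
    have /eqP e2 := s2 e (mem_head _ _).
    have [x xe] : exists x, x \in e by apply/fset0Pn; rewrite -cardfs_eq0 e2.
    have [y xy eE] := fset_card2P e2 xe.
    exists x, y, [::]; split => //=; last by rewrite inE xy.
    by rewrite /adj -eE mem_head.
  have /andP[xy _] := xyp.
  have [w xw wy] := branch _ _ xy.
  exists w, x, (y :: p); split => //=; last by rewrite szp.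
    by rewrite adj_sym xw.
  rewrite -/(uniq (x :: y :: p)) uxyp andbT inE eq_sym negb_or (adj_neq simp xw).
  rewrite inE (negPf wy) /=; apply/negP => wp.
  (* If [w] recurs in [p], the path up to it closes into a cycle through the three distinct vertices
     [x], [y], [w]. *)
  case/splitPr: wp xyp uxyp szp => p1 p2; rewrite -cat_rcons => xyp uxyp _.
  have cyc : path (adj s) x (y :: rcons p1 w).
    by move: xyp; rewrite -cat_cons cat_path => /andP[].
  have ucyc : uniq (x :: y :: rcons p1 w).
    by move: uxyp; rewrite -!cat_cons cat_uniq => /andP[].
  apply: (acyc (x :: y :: rcons p1 w)); first by rewrite /= size_rcons.
  by rewrite /ucycle /cycle ucyc rcons_path cyc /= last_rcons adj_sym xw.
(* [verts] may repeat vertices, but its length still bounds that of a duplicate-free path. *)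
have [x [y [p [xyp uxyp szp]]]] := long (size verts).
suff sub : {subset x :: y :: p <= verts}.
  by have := uniq_leq_size uxyp sub; rewrite /= szp ltnNge leqnSn.
move=> z /(nthP 0) [i ip <-].
case: i ip => [_|i ip] /=; first by case/andP: xyp => /in_verts.
have := pathP 0 xyp i ip; rewrite adj_sym.
exact: in_verts.
Qed.

(** Induction on the number of edges: a leaf becomes the child of its only edge, and the remaining
    edges avoid it, so none of them has it as child. *)
Lemma acyclic_orientation s : simple_graph s -> acyclic_graph s ->
  exists2 ch : edge -> nat, (forall e, e \in s -> ch e \in e)
                          & {in s &, injective ch}.
Proof.
have [n] := ubnP (size s); elim: n s => // n IHn s szs simp acyc.
have [->|s_neq0] := eqVneq s [::]; first by exists (fun=> 0).
have [e [v [es ve leaf]]] := acyclic_leaf simp acyc s_neq0.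
have /andP[us s2] := simp.
have subs f : f \in rem e s -> f \in s by exact: mem_rem.
have [|||ch ch_in ch_inj] := IHn (rem e s).
- by rewrite size_rem //; case: (s) szs s_neq0 => //=; lia.
- rewrite /simple_graph rem_uniq //=; apply/allP => f /subs.
  exact: (allP s2).
- move=> c c2 /andP[cyc uc]; apply: (acyc c c2); rewrite /ucycle uc andbT.
  by apply: sub_cycle cyc => x y; exact: subs.
exists (fun f => if f == e then v else ch f).
  move=> f fs; case: eqP => [-> //|/eqP fe].
  by apply: ch_in; rewrite mem_rem_uniq // inE fe.
have chv f : f \in s -> f != e -> ch f != v.
  move=> fs fe; apply: contraNneq (fe) => chf; apply/eqP/leaf => //.
  by rewrite -chf ch_in // mem_rem_uniq // inE fe.
move=> f g fs gs; case: (eqVneq f e) => [->|fe]; case: (eqVneq g e) => [->|ge] //.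
- by move=> /esym /eqP; rewrite (negPf (chv g gs ge)).
- by move=> /eqP; rewrite (negPf (chv f fs fe)).
by apply: ch_inj; rewrite mem_rem_uniq // inE ?fe ?ge.
Qed.

(** * Fair colorings against proper colorings *)

Lemma proper_degree_le k s (phi : coloring k s) (v : nat) : proper_coloring phi ->
  #|[set i | isSome (phi i) && (v \in nth fset0 s i)]| <= k.
Proof.
move=> /forallP proper.
rewrite -(card_in_imset (f := phi)) => [|i j].
  rewrite -[k in _ <= k]card_ord -[#|'I_k|]/(#|'I_k|.+1.-1) -card_option.
  rewrite -(cardsC1 None) subset_leq_card //.
  apply/fintype.subsetP => x /imsetP[i]; rewrite !inE => /andP[phi_i _] ->.
  by case: (phi i) phi_i.
rewrite !inE => /andP[phi_i vi] /andP[_ vj] /eqP; apply: contraTeq => ij.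
have /forallP /(_ j) /implyP := proper i; apply; rewrite ij phi_i andbT /=.
by apply/fset0Pn; exists v; rewrite inE vi vj.
Qed.

Lemma fair_coloring_bound (R : rcfType) k s (phi psi : coloring k s)
    (q := (2 * Num.sqrt k%:R - 2 : R)%R) :
  0 < k -> simple_graph s -> acyclic_graph s ->
  proper_coloring phi -> proper_coloring psi ->
  (forall i, phi i = None -> forall c, exists2 j, edges_meet i j & phi j = Some c) ->
  (q * (num_colored psi)%:R <= (q + 1) * (num_colored phi)%:R)%R.
Proof.
move=> k_gt0 simp acyc phiP psiP fairP.
have [ch ch_in ch_inj] := acyclic_orientation simp acyc.
pose E (i : 'I_(size s)) := nth fset0 s i; pose c i := ch (E i).
have Es i : E i \in s by exact: mem_nth.
have /andP[us /allP s2] := simp.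
have /choice[p pP] : forall i, exists y, c i != y /\ E i = [fset c i; y].
  move=> i; have [y cy Ey] := fset_card2P (eqP (s2 _ (Es i))) (ch_in _ (Es i)).
  by exists y.
(* [N] bounds all endpoints, so the vertices fit into the finite type ['I_N.+1]. *)
pose N := \max_i maxn (c i) (p i).
have cN i : c i < N.+1.
  by rewrite ltnS (leq_trans (leq_maxl _ (p i))) // (leq_bigmax i).
have pN i : p i < N.+1.
  by rewrite ltnS (leq_trans (leq_maxr (c i) _)) // (leq_bigmax i).
have endE i (v : 'I_N.+1) :
    (inord (c i) == v) || (inord (p i) == v) = ((v : nat) \in E i).
  by rewrite -!val_eqE /= !inordK // (pP i).2 !inE ![_ == v :> nat]eq_sym.
have degE (chi : coloring k s) (v : 'I_N.+1) :
    #|[set i in [set i | isSome (chi i)] | (inord (c i) == v) || (inord (p i) == v)]|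
    = #|[set i | isSome (chi i) && ((v : nat) \in E i)]|.
  by apply: eq_card => i; rewrite !inE endE.
have -> : num_colored psi = #|[set i | isSome (psi i)]|.
  by apply: eq_card => i; rewrite inE.
have -> : num_colored phi = #|[set i | isSome (phi i)]|.
  by apply: eq_card => i; rewrite inE.
apply: (@oriented_forest_bound R k 'I_N.+1 _
          (fun i => inord (c i)) (fun i => inord (p i))) => //.
- move=> i j /(congr1 val); rewrite /= !inordK // => cij; apply: val_inj.
  apply/eqP; rewrite -(nth_uniq fset0 (ltn_ord i) (ltn_ord j) us); apply/eqP.
  exact: ch_inj (Es i) (Es j) cij.
- by move=> i; rewrite -val_eqE /= !inordK //; exact: (pP i).1.
- by move=> v; rewrite degE; exact: proper_degree_le.
- by move=> v; rewrite degE; exact: proper_degree_le.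
move=> i; rewrite inE => phi_i; rewrite !degE !inordK //.
(* [f] picks for each color an edge that blocks [i] with it. These are [k] distinct edges, each
   containing an endpoint of [i], so the two degrees add up to at least [k]. *)
have /choice[f fP] : forall x, exists j, edges_meet i j /\ phi j = Some x.
  move=> x; have [|j] := fairP i _ x; first by case: (phi i) phi_i.
  by exists j.
have f_inj : injective f by move=> x y fxy; have := (fP x).2; rewrite fxy (fP y).2 => -[].
rewrite -[k in k <= _]card_ord -cardsT -(card_imset _ f_inj).
rewrite -cardsUI (leq_trans _ (leq_addr _ _)) // subset_leq_card //.
apply/fintype.subsetP => _ /imsetP[x _ ->]; rewrite !inE (fP x).2 /=.
have [/fset0Pn[v vE] _] := fP x.
move: vE; rewrite inE -![nth _ _ _]/(E _) (pP i).2 !inE.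
by case/andP => /orP[]/eqP -> ->; rewrite ?orbT.
Qed.

Lemma fair_OPT_bound (R : rcfType) k s (A : online_algorithm k)
    (q := (2 * Num.sqrt k%:R - 2 : R)%R) :
  0 < k -> tree_algorithm A -> fair A -> tree_input s ->
  (q * (OPT k s)%:R <= (q + 1) * (num_colored (online_coloring A s))%:R)%R.
Proof.
move=> k_gt0 proper fairA sT; have [simp _ acyc] := sT.
have q1_ge0 : (0 <= q + 1)%R.
  by have := sqrt_nat_ge1 R k_gt0; rewrite /q; lra.
rewrite /OPT; elim/big_ind: _ => [|x y Hx Hy|psi psiP].
- by rewrite mulr0 mulr_ge0.
- by rewrite /maxn; case: ifP.
apply: fair_coloring_bound => // [|i phi_i x]; first exact: proper.
by have [j [_ ij jx]] := fairA s sT i phi_i x; exists j.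
Qed.

(** * Expectation and competitive ratio *)

(** The count is a finite sum of indicators, each of an event whose complement is a rejection. *)
Lemma measurable_num_colored (R : realType) (k : nat) (d : measure_display)
    (Omega : measurableType d) (A : Omega -> online_algorithm k) (s : seq edge) :
  randomized_tree_algorithm A -> tree_input s ->
  measurable_fun setT
    (fun w => (num_colored (online_coloring (A w) s))%:R%R : R).
Proof.
move=> [_ mA] sT.
pose f i w : R := if isSome (online_coloring (A w) s i) then 1%R else 0%R.
rewrite (_ : (fun w => _) = fun w => (\sum_i f i w)%R); last first.
  apply/funext => w; rewrite /num_colored -sum1_card natr_sum big_mkcond.
  by apply: eq_bigr => i _; rewrite /f inE; case: ifP.
apply: measurable_sum => i; apply: measurable_fun_ifT => //.
apply: (measurable_fun_bool false); rewrite setTI.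
rewrite (_ : _ @^-1` _ = [set w | online_coloring (A w) s i = None])%classic.
  exact: mA.
by apply/seteqP; split=> w /=; case: (online_coloring _ _ _).
Qed.

Local Open Scope ring_scope.

Theorem theorem6 (R : realType) (k : nat) (hk : (2 <= k)%N)
  (d : measure_display) (Omega : measurableType d) (P : probability Omega R)
  (FAIR : Omega -> online_algorithm k)
  (hFAIR : randomized_tree_algorithm FAIR)
  (hfair : forall w : Omega, fair (FAIR w)) :
  (((2 * Num.sqrt k%:R - 2) / (2 * Num.sqrt k%:R - 1))%:E
     <= competitive_ratio P FAIR)%E.
Proof.
have k_gt0 : (0 < k)%N by exact: ltnW.
have s1 := sqrt_nat_ge1 R k_gt0.
apply: ereal_sup_ubound; eexists; last by [].
(* The additive constant is 0. With the left side written as the expectation of a constant, it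
   suffices to compare the integrands for each outcome [w]. *)
exists 0 => s sT; rewrite subr0 -[leLHS](expectation_cst P) unlock.
apply: ge0_le_integral => //.
- move=> w _ /=; rewrite lee_fin mulr_ge0 //.
  by apply: divr_ge0; lra.
- by apply/measurable_realfun.measurable_EFinP; exact: measurable_cst.
- by apply/measurable_realfun.measurable_EFinP; exact: measurable_num_colored.
move=> w _; rewrite lee_fin /= mulrAC ler_pdivrMr; last by lra.
have := fair_OPT_bound R k_gt0 (hFAIR.1 w) (hfair w) sT.
by rewrite [X in _ <= X]mulrC (_ : _ - 2 + 1 = 2 * Num.sqrt k%:R - 1 :> R) //; lra.
Qed.
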